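(* Let $\alpha>0$, $s\in(0,1]$, $q\ge1$ and $0\le u<v$. Let $\psi:[u,v]\subset\mathbb{R}_+\to\mathbb{R}^{\alpha}$ be differentiable on $(u,v)$ with $\psi'\in L_1[u,v]$, and suppose $|\psi'|^{q}$ is generalized $s$-convex on $[u,v]$ (with parameter $\alpha$). Then: 1. $$\left|\frac{\psi(u)+\psi(v)}{2}-\frac{\Gamma(\alpha+1)}{2(v-u)^{\alpha}}\left[I_{u^+}^{\alpha}\psi(v)+I_{v^-}^{\alpha}\psi(u)\right]\right|\le\frac{v-u}{2}\left(\frac{1}{\alpha+1}\right)^{\frac{q-1}{q}}\left[\beta(\alpha s+1,\alpha+1)+\frac{1}{\alpha(s+1)+1}\right]^{\frac1q}\left(|\psi'(u)|+|\psi'(v)|\right).$$ 2. If $s=1$, then $$\left|\frac{\psi(u)+\psi(v)}{2}-\frac{\Gamma(\alpha+1)}{2(v-u)^{\alpha}}\left[I_{u^+}^{\alpha}\psi(v)+I_{v^-}^{\alpha}\psi(u)\right]\right|\le\frac{v-u}{2}\left(\frac{1}{1+\alpha}\right)^{\frac{q-1}{q}}\left(\beta(\alpha+1,\alpha+1)+\frac{1}{1+2\alpha}\right)^{\frac1q}\left(|\psi'(u)|^{q}+|\psi'(v)|^{q}\right)^{\frac1q}.$$ 3. If $s=1$ and $\alpha=1$, then $$\left|\frac{\psi(u)+\psi(v)}{2}-\frac{1}{v-u}\int_u^v\psi(x)\,dx\right|\le\frac{v-u}{2}\left(\frac12\right)^{\frac{q-1}{q}}\left(\frac{|\psi'(u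)|^{q}+|\psi'(v)|^{q}}{2}\right)^{\frac1q}.$$
   Context: $\mathbb{R}_+=[0,\infty)$. Values in $\mathbb{R}^{\alpha}$ are treated as ordinary real numbers, and $\psi'$ is the ordinary derivative; $\psi'$ at the endpoints is understood as the one-sided derivative. A function $f$ on an interval $J\subset\mathbb{R}_+$ is generalized $s$-convex (in the second sense, with parameter $\alpha$) if $f(tx+(1-t)y)\le t^{\alpha s}f(x)+(1-t)^{\alpha s}f(y)$ for all $x,y\in J$ and $t\in[0,1]$. Riemann–Liouville fractional integrals: $I_{u^+}^{\alpha}\psi(v)=\frac{1}{\Gamma(\alpha)}\int_u^v(v-t)^{\alpha-1}\psi(t)\,dt$ and $I_{v^-}^{\alpha}\psi(u)=\frac{1}{\Gamma(\alpha)}\int_u^v(t-u)^{\alpha-1}\psi(t)\,dt$. $\beta(\cdot,\cdot)$ is the Euler Beta function. *)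

(* Defs.v *)
From HB Require Import structures.
From mathcomp Require Import all_boot all_order all_algebra.
From mathcomp Require Import all_classical all_reals all_analysis.

Set Implicit Arguments.
Unset Strict Implicit.
Unset Printing Implicit Defensive.

Import Order.TTheory GRing.Theory Num.Theory.
Import numFieldNormedType.Exports.

Local Open Scope classical_set_scope.
Local Open Scope ring_scope.

(* Meaningful for x > 0; the endpoint 0, where the integrand may be singular
   (and 0 `^ a takes a conventional value), is a null set. *)
Definition Euler_Gamma (R : realType) (x : R) : R :=
  \int[lebesgue_measure]_(t in `[0, +oo[) (t `^ (x - 1) * expR (- t)).

(* Meaningful for x, y > 0. The library's beta_fun only takes natural
   parameters. *)
Definition Euler_Beta (R : realType) (x y : R) : R :=
  \int[lebesgue_measure]_(t in `[0, 1])
    (t `^ (x - 1) * (1 - t) `^ (y - 1)).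

(* I_{u^+}^alpha psi (x), for u <= x *)
Definition RL_left (R : realType) (alpha u : R) (psi : R -> R) (x : R) : R :=
  (Euler_Gamma alpha)^-1 *
  \int[lebesgue_measure]_(t in `[u, x]) ((x - t) `^ (alpha - 1) * psi t).

(* I_{v^-}^alpha psi (x), for x <= v *)
Definition RL_right (R : realType) (alpha v : R) (psi : R -> R) (x : R) : R :=
  (Euler_Gamma alpha)^-1 *
  \int[lebesgue_measure]_(t in `[x, v]) ((t - x) `^ (alpha - 1) * psi t).

(* Since 0 `^ a = 0 for a != 0, the cases t = 0 and t = 1 read as usual when
   0 < alpha * s. *)
Definition generalized_s_convex (R : realType) (alpha s : R) (J : set R)
    (f : R -> R) : Prop :=
  forall x y t : R, J x -> J y -> 0 <= t <= 1 ->
    f (t * x + (1 - t) * y) <=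
      t `^ (alpha * s) * f x + (1 - t) `^ (alpha * s) * f y.

(* dpsi is the derivative of psi on [u, v]: the ordinary one inside, the
   one-sided ones at u and v. Only the values of psi on [u, v] matter. *)
Definition is_derivative_on (R : realType) (u v : R) (psi dpsi : R -> R) :
    Prop :=
  [/\ forall x : R, u < x < v -> is_derive x (1 : R) psi (dpsi x),
      (h^-1 * (psi (u + h) - psi u)) @[h --> (0 : R)^'+] --> dpsi u &
      (h^-1 * (psi (v + h) - psi v)) @[h --> (0 : R)^'-] --> dpsi v].

(* Main.v *)
Require Import Defs.
From HB Require Import structures.
From mathcomp Require Import all_boot all_order all_algebra.
From mathcomp Require Import all_classical all_reals all_analysis.
From mathcomp Require Import measurable_realfun ring lra.

Set Implicit Arguments.
Unset Strict Implicit.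
Unset Printing Implicit Defensive.

Import Order.TTheory GRing.Theory Num.Theory.
Import numFieldNormedType.Exports.

Local Open Scope classical_set_scope.
Local Open Scope ring_scope.

(** Write [L = v - u], [phi t = psi t + psi (u + v - t)], [p = alpha * s],
    [a = |psi' u|] and [b = |psi' v|].

    The reflection [t -> u + v - t] turns the left fractional integral into an
    integral with the weight [(t - u)^(alpha - 1)] of the right one. As
    Gamma (alpha + 1) = alpha Gamma (alpha) and this weight has total mass
    [L^alpha / alpha], the quantity to be bounded is
    [alpha / (2 L^alpha)] times the integral over [u, v] of
    [(t - u)^(alpha - 1) (phi v - phi t)]  ([trapezoid_defectE]).
    Only increments of [phi] occur, and the mean value inequality bounds them by
    an explicit primitive of any bound of [phi'] by a constant plus a power.
    Since [phi] is symmetric about the midpoint, such a bound is only needed on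
    the right half of the segment ([trapezoid_defect_le]).

    The derivative [phi' x = psi' x - psi' (u + v - x)] is a difference, and this
    gives [|phi' x| <= (a + b) tau^(p/q)] with [tau = (x - u) / L >= 1/2]
    ([reflected_derivative_le]). If both values have the same sign, the
    difference is at most the larger one, which convexity between [u] and [v]
    bounds. If the signs differ, Darboux's theorem yields a zero of [psi'] in
    between, and convexity between that zero and each endpoint bounds the two
    values by [b tau^(p/q)] and [a tau^(p/q)] separately. Adding up the bounds
    that convexity between [u] and [v] gives for the two values is too crude:
    for [b = 0] and [q] large it amounts to bounding the integral of
    [|(1 - t)^alpha - t^alpha|] over [0, 1] by [1 / (alpha + 1)], which fails
    for [alpha > 1].

    The first claim follows by integrating this power: the result is
    [(L / 2) (a + b) / (alpha + p/q + 1)], and the weighted inequality between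
    the arithmetic and geometric means of [alpha + 1] and [alpha + p + 1]
    compares it with the bound claimed. The Beta value only increases that bound.

    For the second claim, [p = alpha]. If [alpha > 1], convexity at a single point
    forces [psi' = 0]. If [alpha <= 1], the power [tau^(p/q)] is replaced by a
    tangent of [y -> y^(1/q)] at a suitable value of [y = tau^p]; the constant part
    then only meets the mass [(1 - 2^(- alpha)) / (alpha + 1)
    <= 1 / (2 (alpha + 1))], and the factor 1/2 gained pays for the passage from
    [a + b] to the power mean of [a] and [b]. The third claim is the second one at
    [alpha = 1], where the Beta value is 1/6. *)

(** * Derivatives of powers and the fundamental theorem on an open interval *)

Lemma is_derive_continuous (R : realType) (f : R -> R) (x d : R) :
  is_derive x (1 : R) f d -> {for x, continuous f}.
Proof.
by move=> df; apply/differentiable_continuous/derivable1_diffP; exact: ex_derive.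
Qed.

Lemma continuous_powR (R : realType) (p x : R) : 0 < x ->
  {for x, continuous (fun y : R => y `^ p)}.
Proof. by move=> /(is_derive1_powR p)/is_derive_continuous. Qed.

Lemma is_derive_powR_shift (R : realType) (u p t : R) : u < t ->
  is_derive t (1 : R) (fun t => (t - u) `^ p) (p * (t - u) `^ (p - 1)).
Proof.
move=> ut; have tu : 0 < t - u by rewrite subr_gt0.
have dS : is_derive t (1 : R) (fun y : R => y - u) 1.
  apply: is_derive_eq (is_deriveD (is_derive_id t (1 : R))
    (is_derive_cst (- u) t (1 : R))) _.
  by rewrite addr0.
apply: is_derive_eq (@is_derive1_comp R (fun z => z `^ p) (fun t => t - u) t _ _
  (is_derive1_powR p tu) dS) _.
by rewrite mulr1.
Qed.

(** On each segment the two integrals differ by an increment of [F], and both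
    converge monotonically. Two nonnegative functions and values in the extended
    reals give integration by parts with a singular endpoint before either
    integral is known to be finite; [g = 0] gives an improper integral. *)
Lemma ge0_exhaustion_FTC (R : realType) (a b : nat -> R) (f g F : R -> R)
    (l : R) (D := \bigcup_n `[a n, b n]%classic) :
  (forall n, a n < b n) ->
  nonincreasing_seq a -> nondecreasing_seq b ->
  (forall x, D x -> [/\ 0 <= f x, 0 <= g x,
     {for x, continuous f} & {for x, continuous g}]) ->
  (forall x, D x -> is_derive x (1 : R) F (f x - g x)) ->
  (fun n => F (b n) - F (a n)) @ \oo --> l ->
  (\int[lebesgue_measure]_(x in D) (f x)%:E
   = \int[lebesgue_measure]_(x in D) (g x)%:E + l%:E)%E.
Proof.
move=> ab adec binc fg dF Fl.
have Dn n : [set` `[a n, b n]] `<=` D by move=> x xn; exists n.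
have withinC (h : R -> R) n : (forall x, D x -> {for x, continuous h}) ->
    {within `[a n, b n], continuous h}.
  by move=> hc; apply: continuous_in_subspaceT => x /set_mem/Dn/hc.
have fc x : D x -> {for x, continuous f} by move=> /fg[].
have gc x : D x -> {for x, continuous g} by move=> /fg[].
have Fc x : D x -> {for x, continuous F}.
  by move=> /dF/is_derive_continuous.
have int (h : R -> R) n : (forall x, D x -> {for x, continuous h}) ->
    lebesgue_measure.-integrable `[a n, b n] (EFin \o h).
  by move=> hc; apply: continuous_compact_integrable;
    [exact: segment_compact|exact: withinC].
have FTC n : (\int[lebesgue_measure]_(x in `[a n, b n]) (f x)%:E =
    \int[lebesgue_measure]_(x in `[a n, b n]) (g x)%:E + (F (b n) - F (a n))%:E)%E.
  rewrite EFinB -(@continuous_FTC2 R (fun x => f x - g x) F (a n) (b n) (ab n)).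
  - rewrite integralB_EFin//; [|exact: int..].
    rewrite addeC subeK//.
    by apply: integrable_fin_num => //; exact: int.
  - apply: withinC => x Dx; apply: continuousB; [exact: fc|exact: gc].
  - split.
    + by move=> x /subset_itv_oo_cc/Dn/dF Fx; exact: ex_derive.
    + by apply: cvg_at_right_filter; apply: Fc; apply: (Dn n);
        rewrite /= in_itv/= lexx ltW.
    + by apply: cvg_at_left_filter; apply: Fc; apply: (Dn n);
        rewrite /= in_itv/= lexx ltW.
  - move=> x /subset_itv_oo_cc/Dn/dF Fx.
    by rewrite derive1E derive_val.
have itv_nd : nondecreasing_seq (fun n => [set` `[a n, b n]]).
  move=> m n mn; rewrite subsetEset; apply: subset_itv; rewrite bnd_simp.
    exact: adec.
  exact: binc.
have lim (h : R -> R) : (forall x, D x -> 0 <= h x /\ {for x, continuous h}) ->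
    (\int[lebesgue_measure]_(x in `[a n, b n]) (h x)%:E @[n --> \oo] -->
     \int[lebesgue_measure]_(x in D) (h x)%:E)%E.
  move=> hD; apply: (@ge0_nondecreasing_set_cvg_integral _ _ R) => //.
  - move=> n; have := int h n (fun x Dx => (hD x Dx).2).
    exact: measurable_int.
  - by move=> n x /Dn/hD[h0 _]; rewrite lee_fin.
have limf := lim f (fun x Dx => let: And4 f0 _ fc _ := fg x Dx in conj f0 fc).
have limg := lim g (fun x Dx => let: And4 _ g0 _ gc := fg x Dx in conj g0 gc).
move: limf; under eq_fun do rewrite FTC.
move=> limf.
have limgF : (\int[lebesgue_measure]_(x in `[a n, b n]) (g x)%:E
      + (F (b n) - F (a n))%:E @[n --> \oo] -->
    \int[lebesgue_measure]_(x in D) (g x)%:E + l%:E)%E.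
  by apply: cvgeD => //; [exact: fin_num_adde_defl|
    by apply: cvg_EFin; [exact: nearW|exact: Fl]].
exact: (cvg_unique _ limf limgF).
Qed.

(** * The functional equation of the Gamma function *)

(** Raise [(1 + t) / k <= 1 + t / k <= exp (t / k)] to the power [k]. *)
Lemma powR_le_expR (R : realType) (k t : R) : 1 <= k -> 0 <= t ->
  (1 + t) `^ k <= k `^ k * expR t.
Proof.
move=> k1 t0; have k0 : 0 < k by rewrite (lt_le_trans _ k1).
have -> : 1 + t = k * ((1 + t) / k) by rewrite mulrC divfK// gt_eqF.
rewrite powRM ?(ltW k0) ?divr_ge0 ?addr_ge0 ?(ltW k0)//.
rewrite ler_wpM2l ?powR_ge0//.
have -> : expR t = expR (t / k) `^ k by rewrite -expRM divfK// gt_eqF.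
apply: ge0_ler_powR; rewrite ?nnegrE ?(ltW k0) ?expR_ge0//.
  by rewrite divr_ge0 ?addr_ge0 ?(ltW k0).
apply: le_trans (expR_ge1Dx _).
by rewrite mulrDl mul1r lerD2r invf_le1.
Qed.

Lemma bigcup_itv_invnat_nat (R : realType) :
  \bigcup_n `[n.+2%:R^-1, n.+2%:R]%classic = `]0, +oo[%classic :> set R.
Proof.
apply/seteqP; split => [x [n _]|x] /=; rewrite !in_itv/=.
  by move=> /andP[nx _]; rewrite andbT (lt_le_trans _ nx)// invr_gt0.
rewrite andbT => x0.
have [n nx] : exists n : nat, x < n%:R /\ x^-1 < n%:R.
  exists (maxn (Num.truncn x) (Num.truncn x^-1)).+1.
  by split; (apply: lt_le_trans (truncnS_gt _) _;
    rewrite ler_nat ltnS) ; [exact: leq_maxl|exact: leq_maxr].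
exists n => //=; rewrite in_itv/=.
have n2 : n%:R <= n.+2%:R :> R by rewrite ler_nat !leqW.
have [xn xVn] := nx.
apply/andP; split; last by rewrite (le_trans (ltW xn)).
rewrite -[leRHS]invrK lef_pV2 ?posrE ?invr_gt0//.
by rewrite (le_trans (ltW xVn)).
Qed.

Section Gamma.
Variables (R : realType) (x : R).
Hypothesis x0 : 0 < x.
Let mu := @lebesgue_measure R.

Let invnat_dec : nonincreasing_seq (fun n => n.+2%:R^-1 : R).
Proof. by move=> m n mn; rewrite lef_pV2 ?posrE// ler_nat !ltnS. Qed.

Let nat_inc : nondecreasing_seq (fun n => n.+2%:R : R).
Proof. by move=> m n mn; rewrite ler_nat !ltnS. Qed.

Let invnat_lt_nat n : n.+2%:R^-1 < n.+2%:R :> R.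
Proof.
rewrite (@lt_le_trans _ _ 1)// ?ler1n// invf_lt1// ltr1n//.
Qed.

Let inv_nat_cvg0 : (n.+2%:R^-1 : R) @[n --> \oo] --> (0 : R).
Proof. by rewrite (@cvg_shiftS _ (@harmonic R)); exact: cvg_harmonic. Qed.

Let powR_inv_nat_cvg0 (y : R) : 0 < y -> (n.+2%:R^-1 : R) `^ y @[n --> \oo] --> (0 : R).
Proof.
by move=> /(@powR_cvg0 R)/cvg_at_rightP; apply; split => [n|//]; rewrite invr_gt0.
Qed.

(** The majorant is a multiple of the derivative of [(t / (1 + t))^x], which
    increases from 0 to 1: a single function controls the integrand at both ends. *)
Let Gamma_bound (t : R) : 0 < t ->
  t `^ (x - 1) * expR (- t) <= (x + 1) `^ (x + 1) *
    ((t / (1 + t)) `^ (x - 1) * (1 + t) ^- 2).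
Proof.
move=> t0; have t1 : 0 < 1 + t by rewrite addr_gt0.
have -> : (t / (1 + t)) `^ (x - 1) * (1 + t) ^- 2
    = t `^ (x - 1) / (1 + t) `^ (x + 1).
  rewrite powRM ?invr_ge0 ?ltW// -mulrA; congr (_ * _).
  rewrite -{1}(powR_inv1 (ltW t1)) -powRrM mulN1r powRN -invfM; congr (_^-1).
  rewrite -powR_mulrn ?ltW// -powRD; last by rewrite (gt_eqF t1) implybT.
  by congr (_ `^ _); ring.
rewrite mulrCA ler_wpM2l ?powR_ge0// expRN ler_pdivlMr ?powR_gt0//.
rewrite mulrC ler_pdivrMr ?expR_gt0//.
by apply: powR_le_expR; rewrite ?ltW// ltrDr.
Qed.

(** The exponent is free because the derivative [dratio] contains the same ratio
    to the power [x - 1], whose continuity is needed as well. *)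
Let is_derive_ratio (y t : R) : 0 < t ->
  is_derive t (1 : R) (fun t => (t / (1 + t)) `^ y)
    (y * ((t / (1 + t)) `^ (y - 1) * (1 + t) ^- 2)).
Proof.
move=> t0; have t1 : 0 < 1 + t by rewrite addr_gt0.
have t1' : (1 + t) != 0 by rewrite gt_eqF.
have tt0 : 0 < t / (1 + t) by rewrite divr_gt0.
have dS : is_derive t (1 : R) (fun y : R => 1 + y) 1.
  apply: is_derive_eq (is_deriveD (is_derive_cst (1 : R) t (1 : R))
    (is_derive_id t (1 : R))) _.
  by rewrite add0r.
have dV : is_derive t (1 : R) (fun y : R => (1 + y)^-1) (- (1 + t) ^- 2).
  apply: DeriveDef; first exact: (derivableV t1' (@ex_derive _ _ _ _ _ _ _ dS)).
  by rewrite (deriveV t1')// derive_val [LHS]mulr1.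
have dQ : is_derive t (1 : R) (fun y : R => y / (1 + y)) ((1 + t) ^- 2).
  apply: is_derive_eq (is_deriveM (is_derive_id t (1 : R)) dV) _.
  by rewrite /GRing.scale/= mulr1; field.
have := @is_derive1_comp R (fun z => z `^ y) (fun t => t / (1 + t)) t _ _
  (is_derive1_powR y tt0) dQ.
by rewrite mulrA.
Qed.

Let is_derive_dom (t : R) : 0 < t ->
  is_derive t (1 : R) (fun t => t `^ x * expR (- t))
    (x * t `^ (x - 1) * expR (- t) - t `^ x * expR (- t)).
Proof.
move=> t0.
have dE : is_derive t (1 : R) (fun y : R => expR (- y)) (- expR (- t)).
  apply: is_derive_eq (@is_derive1_comp R expR -%R t _ _ _ _) _.
  by rewrite mulrN1.
apply: is_derive_eq (is_deriveM (is_derive1_powR x t0) dE) _.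
rewrite /GRing.scale/=; ring.
Qed.

Lemma powR_expRN_le (t : R) : 0 < t ->
  t `^ x * expR (- t) <= (x + 1) `^ (x + 1) / t.
Proof.
move=> t0; rewrite ler_pdivlMr// mulrAC expRN ler_pdivrMr ?expR_gt0//.
have -> : t `^ x * t = t `^ (x + 1).
  by rewrite powRD ?(gt_eqF t0) ?implybT// powRr1// ltW.
apply: le_trans (powR_le_expR _ (ltW t0)); last by rewrite lerDr ltW.
apply: ge0_ler_powR; rewrite ?nnegrE ?addr_ge0 ?ltW//.
by rewrite ltrDr.
Qed.

Let dom_cvg0 : (n.+2%:R `^ x * expR (- n.+2%:R)) @[n --> \oo] --> (0 : R).
Proof.
apply: (@squeeze_cvgr _ _ _ _ (cst 0)
    (fun n => (x + 1) `^ (x + 1) * n.+2%:R^-1)).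
- apply: nearW => n /=; rewrite mulr_ge0 ?powR_ge0 ?expR_ge0//=.
  exact: powR_expRN_le.
- exact: cvg_cst.
- by rewrite -[X in _ --> X](mulr0 ((x + 1) `^ (x + 1))); exact: cvgMr.
Qed.

Let dratio (t : R) := x * ((t / (1 + t)) `^ (x - 1) * (1 + t) ^- 2).

Let continuous_dratio (t : R) : 0 < t -> {for t, continuous dratio}.
Proof.
move=> t0; apply: continuousM; first exact: cst_continuous.
  apply: continuousM; first exact: is_derive_continuous (is_derive_ratio _ t0).
  apply: continuousV; first by rewrite expf_neq0// gt_eqF// addr_gt0.
  apply: (@continuous_comp _ _ _ (fun y : R => 1 + y) (fun y => y ^+ 2));
    last exact: exprn_continuous.
  by apply: continuousD; [exact: cst_continuous|exact: cvg_id].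
Qed.

Let integral_ratio :
  (\int[mu]_(t in `]0%R, +oo[)
      (dratio t)%:E = 1)%E.
Proof.
rewrite -bigcup_itv_invnat_nat.
apply: etrans (@ge0_exhaustion_FTC R _ _ _ (cst 0)
  (fun t => (t / (1 + t)) `^ x) 1 _ _ _ _ _ _) _ => //;
  rewrite ?bigcup_itv_invnat_nat.
- move=> t /=; rewrite in_itv/= andbT => t0.
  have t1 : 0 < 1 + t by rewrite addr_gt0.
  split => //.
  + by rewrite !mulr_ge0 ?powR_ge0 ?invr_ge0 ?exprn_ge0// ltW.
  + exact: continuous_dratio.
  + exact: cst_continuous.
- by move=> t /=; rewrite in_itv/= andbT subr0 => /is_derive_ratio.
- rewrite -[X in _ --> X]subr0; apply: cvgB.
    have -> : (fun n => (n.+2%:R / (1 + n.+2%:R)) `^ x) =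
        (fun n => (1 + (n.+2%:R : R)^-1)^-1 `^ x).
      apply/funext => n; congr (_ `^ _); field.
      by rewrite !gt_eqF// ?addr_gt0.
    rewrite [X in _ --> X](_ : 1 = (1 : R) `^ x); last by rewrite powR1.
    have c1 : (1 + (n.+2%:R : R)^-1)^-1 @[n --> \oo] --> (1 : R).
      rewrite -[X in _ --> X]invr1; apply: cvgV; first exact: oner_neq0.
      by rewrite -[X in _ --> X]addr0; apply: cvgD => //; exact: cvg_cst.
    exact: (cvg_comp _ _ c1 (@continuous_powR R x 1 ltr01)).
  have /cvg_at_rightP := powR_cvg0 x0.
  apply; split.
    by move=> n; rewrite divr_gt0// addr_gt0.
  rewrite -[X in _ --> X](mul0r ((1 + 0 : R)^-1)).
  apply: cvgM => //; apply: cvgV; first by rewrite addr0 oner_neq0.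
  by apply: cvgD => //; exact: cvg_cst.
- by rewrite integral0 add0e.
Qed.

Lemma integrable_Gamma :
  lebesgue_measure.-integrable `]0, +oo[
    (fun t => (t `^ (x - 1) * expR (- t))%:E).
Proof.
have mG : measurable_fun (`]0, +oo[ : set R)
    (fun t : R => t `^ (x - 1) * expR (- t)).
  apply: measurable_funTS; apply: measurable_funM; first exact: measurable_powR.
  by apply: measurableT_comp.
have ih : lebesgue_measure.-integrable `]0, +oo[ (EFin \o dratio).
  apply/integrableP; split.
    apply/measurable_EFinP; apply: open_continuous_measurable_fun => //.
    by move=> t /set_mem; rewrite /= in_itv/= andbT => /continuous_dratio.
  rewrite (_ : (\int[_]_(t in _) _)%E = 1%E) ?ltry// -integral_ratio.
  apply: eq_integral => t /[!inE]/=; rewrite in_itv/= andbT => t0.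
  rewrite ger0_norm// !mulr_ge0 ?powR_ge0 ?invr_ge0 ?exprn_ge0 ?(ltW x0)//.
  by rewrite addr_ge0// ltW.
apply: (@le_integrable _ _ _ mu _ _ _
  (fun t => ((x + 1) `^ (x + 1) / x)%:E * (dratio t)%:E)%E) => //.
- exact/measurable_EFinP.
- move=> t /=; rewrite in_itv/= andbT => t0.
  rewrite lee_fin ger0_norm ?mulr_ge0 ?powR_ge0 ?expR_ge0//.
  apply: le_trans (Gamma_bound t0) (le_trans _ (ler_norm _)).
  by rewrite /dratio -[X in _ <= X]mulrA mulKf// gt_eqF.
- exact: integrableZl.
Qed.

(** Integration by parts: [t^x exp (- t)] vanishes at 0 and at infinity. *)
Lemma ereal_Gamma_rec :
  (\int[mu]_(t in `]0%R, +oo[) (x * (t `^ (x - 1) * expR (- t)))%:E =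
   \int[mu]_(t in `]0%R, +oo[) (t `^ x * expR (- t))%:E)%E.
Proof.
have cE t : {for t, continuous (fun t : R => expR (- t))}.
  apply: continuous_comp; [exact: opp_continuous|exact: continuous_expR].
rewrite -bigcup_itv_invnat_nat.
apply: etrans (@ge0_exhaustion_FTC R _ _ _ (fun t => t `^ x * expR (- t))
  (fun t => t `^ x * expR (- t)) 0 _ _ _ _ _ _) _ => //;
  rewrite ?adde0// ?bigcup_itv_invnat_nat.
- move=> t /=; rewrite in_itv/= andbT => t0; split.
  + by rewrite !mulr_ge0 ?powR_ge0 ?expR_ge0// ltW.
  + by rewrite !mulr_ge0 ?powR_ge0 ?expR_ge0.
  + apply: continuousM; first exact: cst_continuous.
    by apply: continuousM => //; exact: continuous_powR.
  + by apply: continuousM => //; exact: continuous_powR.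
- by move=> t /=; rewrite in_itv/= andbT mulrA => /is_derive_dom.
- rewrite -[X in _ --> X](subrr 0); apply: cvgB; first exact: dom_cvg0.
  rewrite -[X in _ --> X](mul0r (expR (- 0) : R)); apply: cvgM.
    exact: powR_inv_nat_cvg0.
  by apply: continuous_cvg; [exact: continuous_expR|exact: cvgN].
Qed.

End Gamma.

Lemma Euler_GammaE (R : realType) (x : R) : 0 < x ->
  Euler_Gamma x =
  \int[lebesgue_measure]_(t in `]0, +oo[) (t `^ (x - 1) * expR (- t)).
Proof. by move=> x0; rewrite Rintegral_itv_obnd_cbnd//; exact: integrable_Gamma. Qed.

Lemma Euler_GammaD1 (R : realType) (x : R) : 0 < x ->
  Euler_Gamma (x + 1) = x * Euler_Gamma x.
Proof.
move=> x0; rewrite !Euler_GammaE// ?addr_gt0// addrK.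
rewrite -RintegralZl//; last exact: integrable_Gamma.
by rewrite /Rintegral ereal_Gamma_rec.
Qed.

(** On [1, 2] the integrand is at least [(1 / t) exp (- t)], since [t^x >= 1]. *)
Lemma Euler_Gamma_gt0 (R : realType) (x : R) : 0 < x -> 0 < Euler_Gamma x.
Proof.
move=> x0; rewrite Euler_GammaE//.
have i12 : [set` `[1 : R, 2]] `<=` [set` `]0, +oo[].
  by move=> t /=; rewrite !in_itv/= andbT => /andP[/(lt_le_trans ltr01)].
have iG : lebesgue_measure.-integrable `[1, 2]
    (fun t : R => (t `^ (x - 1) * expR (- t))%:E).
  by apply: integrableS (integrable_Gamma x0).
have G12 : \int[lebesgue_measure]_(t in `[1, 2]) (t `^ (x - 1) * expR (- t))
    <= \int[lebesgue_measure]_(t in `]0, +oo[) (t `^ (x - 1) * expR (- t)).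
  rewrite /Rintegral fine_le//.
  - exact: integrable_fin_num.
  - by apply: integrable_fin_num => //; exact: integrable_Gamma.
  - apply: ge0_subset_integral => //.
      exact: measurable_int (integrable_Gamma x0).
    by move=> t _; rewrite lee_fin mulr_ge0 ?powR_ge0 ?expR_ge0.
apply: lt_le_trans G12.
pose c : R := 2^-1 * expR (- 2).
apply: (@lt_le_trans _ _ (\int[lebesgue_measure]_(t in `[1 : R, 2]) c)).
  rewrite Rintegral_cst//= lebesgue_measure_itv/= lte_fin ltr1n/=.
  by rewrite mulr_gt0// ?mulr_gt0 ?expR_gt0// subr_gt0 ltr1n.
apply: le_Rintegral => //.
  apply: continuous_compact_integrable; first exact: segment_compact.
  by apply: continuous_subspaceT => ?; exact: cst_continuous.
move=> t /=; rewrite in_itv/= => /andP[t1 t2]; rewrite /c ler_pM ?expR_ge0//.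
  have t0 : 0 < t by rewrite (lt_le_trans ltr01).
  rewrite powRB ?(gt_eqF t0) ?implybT// (powRr1 (ltW t0)).
  apply: (@le_trans _ _ (1 / t)); first by rewrite div1r lef_pV2 ?posrE.
  by rewrite ler_wpM2r ?invr_ge0 ?(ltW t0)// -(powRr0 t) ler_powR// ltW.
by rewrite ler_expR lerN2.
Qed.

(** * Integrals of powers over a segment *)

Lemma bigcup_itv_invnat_bnd (R : realType) (u b : R) : u < b ->
  \bigcup_n `[u + (b - u) / n.+2%:R, b]%classic = `]u, b]%classic.
Proof.
move=> ub; have bu : 0 < b - u by rewrite subr_gt0.
apply/seteqP; split => [x [n _]|x] /=; rewrite !in_itv/= => /andP[ux xb].
  by rewrite xb andbT (lt_le_trans _ ux)// ltrDl divr_gt0.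
pose n := (Num.truncn ((b - u) / (x - u))).+1.
have xu : 0 < x - u by rewrite subr_gt0.
exists n => //=; rewrite in_itv/= xb andbT -lerBrDl ler_pdivrMr//.
rewrite mulrC -ler_pdivrMr//; apply: le_trans (ltW (truncnS_gt _)) _.
by rewrite ler_nat; do 2 apply: leqW.
Qed.

Section powR_integral.
Variables (R : realType) (u b p : R).
Hypotheses (ub : u < b) (p0 : -1 < p).
Let mu := @lebesgue_measure R.

Let p1 : 0 < p + 1. Proof. by rewrite -ltrBlDr sub0r. Qed.

Let bu : 0 < b - u. Proof. by rewrite subr_gt0. Qed.

(** The difference with 0 is the shape [f - g] of the improper fundamental
    theorem, with [g = 0]. *)
Let is_derive_primitive (t : R) : u < t ->
  is_derive t (1 : R) (fun t => (t - u) `^ (p + 1) / (p + 1)) ((t - u) `^ p - 0).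
Proof.
move=> ut.
apply: is_derive_eq (is_deriveM (is_derive_powR_shift (p + 1) ut)
  (is_derive_cst (p + 1)^-1 t (1 : R))) _.
by rewrite /GRing.scale/= mulr0 add0r addrK subr0 mulKf// gt_eqF.
Qed.

Let mpow (A : set R) : measurable_fun A (fun t : R => (t - u) `^ p).
Proof.
apply: measurable_funTS.
apply: (@measurableT_comp _ _ _ _ _ _ (fun y : R => y `^ p)) => //.
exact: measurable_funB.
Qed.

Let ereal_integral_powR :
  (\int[mu]_(t in `[u, b]) ((t - u) `^ p)%:E
   = ((b - u) `^ (p + 1) / (p + 1))%:E)%E.
Proof.
rewrite -integral_itv_obnd_cbnd; last first.
  by apply/measurable_EFinP; exact: mpow.
rewrite -bigcup_itv_invnat_bnd//.
apply: etrans (@ge0_exhaustion_FTC R _ _ _ (cst 0)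
  (fun t => (t - u) `^ (p + 1) / (p + 1))
  ((b - u) `^ (p + 1) / (p + 1)) _ _ _ _ _ _) _;
  rewrite ?bigcup_itv_invnat_bnd//.
- by move=> n /=; rewrite -ltrBrDl ltr_pdivrMr// ltr_pMr// ltr1n.
- move=> m n mn /=; rewrite lerD2l ler_pM2l//.
  by rewrite lef_pV2 ?posrE// ler_nat !ltnS.
- move=> t /=; rewrite in_itv/= => /andP[ut tb]; split.
  + exact: powR_ge0.
  + by [].
  + apply: (@continuous_comp _ _ _ (fun y : R => y - u) (fun y => y `^ p)).
      by apply: continuousB; [exact: cvg_id|exact: cst_continuous].
    by apply: continuous_powR; rewrite subr_gt0.
  + exact: cst_continuous.
- by move=> t /=; rewrite in_itv/= => /andP[/is_derive_primitive].
- rewrite -[X in _ --> X]subr0; apply: cvgB; first exact: cvg_cst.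
  rewrite -[X in _ --> X](mul0r (p + 1)^-1); apply: cvgMl.
  have /cvg_at_rightP := powR_cvg0 p1.
  apply; split=> [n|]; first by rewrite addrC addKr divr_gt0.
  have -> : (fun n => u + (b - u) / n.+2%:R - u)
      = (fun n => (b - u) * n.+2%:R^-1) :> (nat -> R).
    by apply/funext => n; rewrite addrC addKr.
  rewrite -[X in _ --> X](mulr0 (b - u)); apply: cvgMr.
  by rewrite (@cvg_shiftS _ (@harmonic R)); exact: cvg_harmonic.
- by rewrite integral0 add0e.
Qed.

Lemma integrable_powR_shift :
  mu.-integrable `[u, b] (fun t => ((t - u) `^ p)%:E).
Proof.
apply/integrableP; split; first by apply/measurable_EFinP; exact: mpow.
under eq_integral => t _ do rewrite /= ger0_norm ?powR_ge0//.
by rewrite ereal_integral_powR ltry.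
Qed.

Lemma Rintegral_powR_shift :
  \int[mu]_(t in `[u, b]) ((t - u) `^ p) = (b - u) `^ (p + 1) / (p + 1).
Proof. by rewrite /Rintegral ereal_integral_powR. Qed.

End powR_integral.

(** * Reflection of a segment *)

(** The integrands are unbounded at an endpoint, so substitution for continuous
    integrands does not apply; invariance of Lebesgue measure under [x -> c - x]
    is used instead, and integrands are extended by 0 to be measurable on the
    whole line. *)
Section reflection.
Variables (R : realType) (c : R).
Let mu := @lebesgue_measure R.
Let refl : measurableTypeR R -> measurableTypeR R := fun x => c - x.

Let mrefl : measurable_fun setT refl.
Proof. by apply: measurable_funB. Qed.

HB.instance Definition _ := @isMeasurableFun.Build _ _ _ _ refl mrefl.

Let preimage_reflect (a b : R) (b0 b1 : bool) :
  refl @^-1` [set` Interval (BSide b0 a) (BSide b1 b)] =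
  [set` Interval (BSide (~~ b1) (c - b)) (BSide (~~ b0) (c - a))].
Proof.
apply/seteqP; split => x; rewrite /refl /= !in_itv/=;
  by case: b0; case: b1 => /= /andP[]; lra.
Qed.

Lemma lebesgue_measure_reflect (A : set R) : measurable A ->
  pushforward mu refl A = mu A.
Proof.
move=> mA; apply/esym/lebesgue_measure_unique => //= _ [[a b]] _ <-.
rewrite /pushforward preimage_reflect/= /mu !lebesgue_measure_itv/= !lte_fin.
rewrite ltrD2l ltrN2; case: ifP => // _; rewrite -!EFinB; congr EFin; ring.
Qed.

Let integral_reflect (f : R -> \bar R) (a b : R) :
  (\int[pushforward mu refl]_(x in `[a, b]) f x = \int[mu]_(x in `[a, b]) f x)%E.
Proof. by apply: eq_measure_integral => A mA _; exact: lebesgue_measure_reflect. Qed.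

Variables (u v : R) (f : R -> R).
Hypotheses (cuv : c = u + v)
  (intf : mu.-integrable `[u, v] (EFin \o f)).

Let g := f \_ `[u, v].

Let mg : measurable_fun [set: R] (EFin \o g).
Proof.
apply/measurable_EFinP; apply/(measurable_restrictT f) => //.
by apply/measurable_EFinP; exact: measurable_int intf.
Qed.

Let mgrefl : measurable_fun [set: R] (EFin \o (g \o refl)).
Proof. exact: (measurableT_comp mg mrefl). Qed.

Let preimage_itv : refl @^-1` `[u, v] = `[u, v]%classic.
Proof. by rewrite preimage_reflect/= cuv addrK addrAC subrr add0r. Qed.

Let g_refl x : x \in `[u, v] -> g (refl x) = f (c - x).
Proof.
move=> xuv; rewrite /g patchE mem_set//=.
by move: xuv; rewrite /refl !in_itv/= cuv => /andP[]; lra.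
Qed.

Lemma integrable_reflect :
  mu.-integrable `[u, v] (EFin \o (fun x => f (c - x))).
Proof.
suff : mu.-integrable `[u, v] (EFin \o (g \o refl)).
  apply: eq_integrable => // x; rewrite inE => xuv.
  by rewrite /= g_refl.
apply/integrableP; split.
  exact: measurable_funTS mgrefl.
have /integrableP[_] := intf; apply: le_lt_trans.
rewrite -{1}preimage_itv.
have := @ge0_integral_pushforward _ _ _ _ R refl mrefl mu `[u, v]
  (fun x => `|(g x)%:E|%E).
rewrite /= => <- //.
- rewrite integral_reflect le_eqVlt; apply/orP; left; apply/eqP.
  by apply: eq_integral => x xuv; rewrite /g patchE xuv.
- exact: (measurable_funTS (measurableT_comp (@abse_measurable R setT) mg)).
Qed.

Lemma Rintegral_reflect :
  \int[mu]_(x in `[u, v]) f (c - x) = \int[mu]_(x in `[u, v]) f x.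
Proof.
congr fine.
transitivity (\int[mu]_(x in refl @^-1` `[u, v]) ((EFin \o g) \o refl) x)%E.
  rewrite preimage_itv; apply: eq_integral => x; rewrite inE => xuv.
  by rewrite /= g_refl.
rewrite -(@integral_pushforward _ _ _ _ _ refl)//.
  rewrite integral_reflect.
  by apply: eq_integral => x xuv; rewrite /= /g patchE xuv.
rewrite preimage_itv; apply: eq_integrable integrable_reflect => // x.
by rewrite inE => xuv; rewrite /= g_refl.
Qed.

End reflection.

(** * Continuity up to the endpoints and the mean value inequality *)

(** At an endpoint, [psi] minus its value there is the difference quotient times
    a null sequence. *)
Lemma is_derivative_on_continuous (R : realType) (u v : R) (psi dpsi : R -> R) :
  u < v -> is_derivative_on u v psi dpsi -> {within `[u, v], continuous psi}.
Proof.
move=> uv [dint /cvg_at_rightP du /cvg_at_leftP dv].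
apply/continuous_within_itvP => //; split.
- by move=> x; rewrite in_itv/= => /dint/is_derive_continuous.
- apply/cvg_at_rightP => w [wu wcu].
  have wu0 : w n - u @[n --> \oo] --> 0.
    by rewrite -[X in _ --> X](subrr u); apply: cvgB => //; exact: cvg_cst.
  have /du dw : (forall n, w n - u > 0) /\ (w n - u @[n --> \oo] --> 0).
    by split => // n; rewrite subr_gt0.
  rewrite -[X in _ --> X](addr0 (psi u)) -(mul0r (dpsi u)).
  have -> : (fun n => psi (w n)) = (fun n => psi u + (w n - u) *
      ((w n - u)^-1 * (psi (u + (w n - u)) - psi u))).
    apply/funext => n.
    by rewrite subrKC mulVKf ?subrKC// gt_eqF// subr_gt0.
  by apply: cvgD; [exact: cvg_cst|exact: cvgM wu0 dw].
- apply/cvg_at_leftP => w [wv wcv].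
  have wv0 : w n - v @[n --> \oo] --> 0.
    by rewrite -[X in _ --> X](subrr v); apply: cvgB => //; exact: cvg_cst.
  have /dv dw : (forall n, w n - v < 0) /\ (w n - v @[n --> \oo] --> 0).
    by split => // n; rewrite subr_lt0.
  rewrite -[X in _ --> X](addr0 (psi v)) -(mul0r (dpsi v)).
  have -> : (fun n => psi (w n)) = (fun n => psi v + (w n - v) *
      ((w n - v)^-1 * (psi (v + (w n - v)) - psi v))).
    apply/funext => n.
    by rewrite subrKC mulVKf ?subrKC// lt_eqF// subr_lt0.
  by apply: cvgD; [exact: cvg_cst|exact: cvgM wv0 dw].
Qed.

Lemma within_continuous_reflect (R : realType) (u v : R) (f : R -> R) :
  u < v -> {within `[u, v], continuous f} ->
  {within `[u, v], continuous (fun x => f (u + v - x))}.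
Proof.
move=> uv /(continuous_within_itvP _ uv)[fi /cvg_at_rightP fu /cvg_at_leftP fv].
apply/(continuous_within_itvP _ uv); split.
- move=> x xuv; apply: (@continuous_comp _ _ _ (fun y => u + v - y) f).
    by apply: continuousB; [exact: cst_continuous|exact: cvg_id].
  by apply: fi; move: xuv; rewrite !in_itv/= => /andP[]; lra.
- rewrite (_ : u + v - u = v); last by ring.
  apply/cvg_at_rightP => w [wu wcu]; apply: fv; split=> [n|].
    by have := wu n; lra.
  rewrite [X in _ --> X](_ : v = u + v - u); last by ring.
  by apply: cvgB => //; exact: cvg_cst.
- rewrite (_ : u + v - v = u); last by ring.
  apply/cvg_at_leftP => w [wv wcv]; apply: fu; split=> [n|].
    by have := wv n; lra.
  rewrite [X in _ --> X](_ : u = u + v - v); last by ring.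
  by apply: cvgB => //; exact: cvg_cst.
Qed.

(** Both [g - f] and [g + f] are nondecreasing. The increment runs to the right
    end [b], where the values of [phi] will be compared. *)
Lemma mean_value_bound (R : realType) (a b : R) (f g df dg : R -> R) :
  {within `[a, b], continuous f} -> {within `[a, b], continuous g} ->
  (forall x, x \in `]a, b[ -> [/\ is_derive x (1 : R) f (df x),
    is_derive x (1 : R) g (dg x) & `|df x| <= dg x]) ->
  forall t, t \in `[a, b] -> `|f b - f t| <= g b - g t.
Proof.
move=> cf cg dfg t tab.
have mono (h dh : R -> R) : {within `[a, b], continuous h} ->
    (forall x, x \in `]a, b[ -> is_derive x (1 : R) h (dh x) /\ 0 <= dh x) ->
    h t <= h b.
  move=> ch dhP; apply: (@ger0_derive1_le_cc R h a b) => //.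
  - by move=> x /dhP[]? _; exact: ex_derive.
  - by move=> x /dhP[]? ?; rewrite derive1E derive_val.
  - by move: tab; rewrite !in_itv/= => /andP[/le_trans h1 /h1 ->]/=.
  - by move: tab; rewrite in_itv/= => /andP[].
have fgP : g t - f t <= g b - f b.
  apply: (mono (g - f) (dg - df)) => [x|x /dfg[f' g' /ler_normlP[]]].
    exact: (continuousB (cg x) (cf x)).
  by split; [exact: is_deriveB|rewrite subr_ge0].
have fgN : g t + f t <= g b + f b.
  apply: (mono (g + f) (dg + df)) => [x|x /dfg[f' g' /ler_normlP[? ?]]].
    exact: (continuousD (cg x) (cf x)).
  by split; [exact: is_deriveD|change (0 <= dg x + df x); lra].
by rewrite ler_norml; apply/andP; split; lra.
Qed.

(** * The trapezoid defect of the fractional integrals *)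

Lemma integrable_powR_mul (R : realType) (u v p : R) (f : R -> R) :
  u < v -> -1 < p -> {within `[u, v], continuous f} ->
  lebesgue_measure.-integrable `[u, v] (EFin \o (fun t => (t - u) `^ p * f t)).
Proof.
move=> uv p1 cf.
have := @integrableMl _ _ R lebesgue_measure `[u, v] _ (fun t => ((t - u) `^ p)%:E) f
  (integrable_powR_shift uv p1).
apply => //.
  exact: subspace_continuous_measurable_fun.
have /compact_bounded[M [Mr fM]] :=
  continuous_compact cf (@segment_compact R u v).
by exists M; split => // z Mz t tuv; apply: fM Mz _ _; exists t.
Qed.

Lemma within_continuous_powR_shift (R : realType) (u v p : R) : u < v -> 0 < p ->
  {within `[u, v], continuous (fun t => (t - u) `^ p)}.
Proof.
move=> uv p0; apply/(continuous_within_itvP _ uv); split.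
- move=> x; rewrite in_itv/= => /andP[ux _].
  exact: is_derive_continuous (is_derive_powR_shift p ux).
- rewrite subrr powR0 ?gt_eqF//.
  apply/cvg_at_rightP => w [wu wcu].
  have /cvg_at_rightP := powR_cvg0 p0; apply; split=> [n|].
    by rewrite subr_gt0.
  by rewrite -[X in _ --> X](subrr u); apply: cvgB => //; exact: cvg_cst.
- apply: cvg_at_left_filter.
  exact: is_derive_continuous (is_derive_powR_shift p uv).
Qed.

Section trapezoid.
Variables (R : realType) (u v alpha : R).
Hypotheses (uv : u < v) (alpha0 : 0 < alpha).
Let mu := @lebesgue_measure R.
Let w t : R := (t - u) `^ (alpha - 1).

Let L0 : 0 < v - u. Proof. by rewrite subr_gt0. Qed.
Let p1 : -1 < alpha - 1. Proof. by rewrite ltrBrDl subrr. Qed.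

Let integral_w (b : R) : u < b ->
  \int[mu]_(t in `[u, b]) w t = (b - u) `^ alpha / alpha.
Proof. by move=> ub; rewrite Rintegral_powR_shift// subrK. Qed.

Definition trapezoid_defect (psi : R -> R) := (psi u + psi v) / 2
  - Euler_Gamma (alpha + 1) / (2 * (v - u) `^ alpha)
    * (RL_left alpha u psi v + RL_right alpha v psi u).

(** The constant [phi v = psi u + psi v] can be put under the integral because the
    weight has mass [(v - u)^alpha / alpha]. *)
Lemma trapezoid_defectE (psi : R -> R) (phi := fun t => psi t + psi (u + v - t)) :
  {within `[u, v], continuous psi} ->
  trapezoid_defect psi = alpha / (2 * (v - u) `^ alpha)
    * \int[mu]_(t in `[u, v]) (w t * (phi v - phi t)).
Proof.
move=> cpsi.
have cpsi' := within_continuous_reflect uv cpsi.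
have iw := integrable_powR_shift uv p1.
have i1 := integrable_powR_mul uv p1 cpsi.
have i2 := integrable_powR_mul uv p1 cpsi'.
have G0 := Euler_Gamma_gt0 alpha0.
have leftE : \int[mu]_(t in `[u, v]) ((v - t) `^ (alpha - 1) * psi t)
    = \int[mu]_(t in `[u, v]) (w t * psi (u + v - t)).
  rewrite -(Rintegral_reflect erefl i2); apply: eq_Rintegral => t _.
  by rewrite /w; congr (_ `^ _ * psi _); ring.
have -> : \int[mu]_(t in `[u, v]) (w t * (phi v - phi t)) =
    phi v * ((v - u) `^ alpha / alpha) - (\int[mu]_(t in `[u, v]) (w t * psi (u + v - t))
     + \int[mu]_(t in `[u, v]) (w t * psi t)).
  rewrite -RintegralD// -integral_w// -RintegralZl// -RintegralB//.
  - by apply: eq_Rintegral => t _; rewrite /phi; ring.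
  - exact: (integrableZl _ (phi v) iw).
  - exact: (integrableD _ i2 i1).
rewrite /trapezoid_defect /RL_left /RL_right leftE Euler_GammaD1//.
have La : (v - u) `^ alpha != 0 by rewrite gt_eqF ?powR_gt0.
rewrite /phi (_ : u + v - v = u); last by ring.
field; rewrite La !gt_eqF//.
Qed.

Let cmin : {within `[u, v], continuous (fun t => Num.min (t - u) (v - t))}.
Proof.
apply: continuous_subspaceT => t.
by apply: (@continuous_min R R (fun t => t - u) (fun t => v - t));
  apply: continuousB; do ?[exact: cst_continuous|exact: cvg_id].
Qed.

(** The minimum is the distance to the nearer endpoint, which bounds an increment
    of [phi] when [phi'] is bounded by 1 on the right half. *)
Lemma Rintegral_powR_min :
  \int[mu]_(t in `[u, v]) (w t * Num.min (t - u) (v - t))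
  = (v - u) `^ alpha * (v - u) * (1 - 2 `^ (- alpha)) / (alpha * (alpha + 1)).
Proof.
have a1 : -1 < alpha by rewrite (lt_trans _ alpha0)// ltrN10.
pose m := (u + v) / 2.
have [um mv] : u < m /\ m < v by rewrite /m !midf_lt.
have imin := integrable_powR_mul uv p1 cmin.
have wM (t : R) : u <= t -> w t * (t - u) = (t - u) `^ alpha.
  by move=> ut; rewrite mulrC mulr_powRB1// subr_ge0.
pose h t := (v - u) * w t - (t - u) `^ alpha.
have ih b : u < b -> mu.-integrable `[u, b] (EFin \o h).
  move=> ub; apply: (integrableB _ (integrableZl _ (v - u) (integrable_powR_shift ub p1))
    (integrable_powR_shift ub a1)) => //.
have inth b : u < b -> \int[mu]_(t in `[u, b]) h t
    = (v - u) * ((b - u) `^ alpha / alpha) - (b - u) `^ (alpha + 1) / (alpha + 1).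
  move=> ub; rewrite RintegralB//; last 2 first.
  - exact: (integrableZl _ _ (integrable_powR_shift ub p1)).
  - exact: integrable_powR_shift.
  rewrite RintegralZl//; last exact: integrable_powR_shift.
  by rewrite integral_w// Rintegral_powR_shift.
have left : \int[mu]_(t in `[u, m]) (w t * Num.min (t - u) (v - t))
    = (m - u) `^ (alpha + 1) / (alpha + 1).
  rewrite -Rintegral_powR_shift//; apply: eq_Rintegral => t /set_mem/=.
  rewrite in_itv/= => /andP[ut tm]; rewrite min_l ?wM//.
  by move: tm; rewrite /m; lra.
(* On the right half the integrand is [h], which is integrable up to [u], so its
   integral is again a difference of two power integrals starting at [u]. *)
have right : \int[mu]_(t in `]m, v]) (w t * Num.min (t - u) (v - t))
    = \int[mu]_(t in `[u, v]) h t - \int[mu]_(t in `[u, m]) h t.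
  rewrite Rintegral_itvB ?bnd_simp ?ltW//; last exact: ih.
  apply: eq_Rintegral => t /set_mem/=; rewrite in_itv/= => /andP[mt tv].
  rewrite min_r; last by move: mt; rewrite /m; lra.
  by rewrite /h -wM ?(ltW (lt_trans um mt))//; ring.
have := @Rintegral_itvB R _ _ _ m imin.
rewrite !bnd_simp => /(_ (ltW um) (ltW mv)).
rewrite right left => /eqP; rewrite subr_eq => /eqP ->.
rewrite !inth//.
have Lp (b : R) : u < b -> (b - u) `^ (alpha + 1) = (b - u) `^ alpha * (b - u).
  move=> ub; rewrite powRD; last by rewrite subr_eq0 (gt_eqF ub) implybT.
  by rewrite powRr1// subr_ge0 ltW.
rewrite !Lp// (_ : m - u = (v - u) / 2); last by rewrite /m; field.
rewrite powRM ?invr_ge0 ?(ltW L0)//.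
have -> : (2^-1 : R) `^ alpha = 2 `^ (- alpha).
  by rewrite -(@powR_inv1 R 2)// -powRrM mulN1r.
by field; rewrite !gt_eqF// addr_gt0.
Qed.

(** The increments of [phi] towards [v] are bounded by those of a primitive [g] of
    the majorant on the right half, hence by [B] on the whole segment: to the left
    of the midpoint [phi t = phi (u + v - t)]. There the distance to the nearer
    endpoint is kept for the constant part, because the factor 1/2 it saves is
    needed when [s = 1]; for the power part the weaker expression valid on both
    halves is enough. *)
Lemma trapezoid_defect_le (psi dpsi : R -> R) (C K rho : R) :
  0 <= C -> 0 <= K -> 0 <= rho ->
  is_derivative_on u v psi dpsi ->
  (forall x, (u + v) / 2 < x < v ->
    `|dpsi x - dpsi (u + v - x)| <= C + K * (x - u) `^ rho) ->
  `|trapezoid_defect psi| <= (v - u) / 2 *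
    (C * ((1 - 2 `^ (- alpha)) / (alpha + 1))
     + K * ((v - u) `^ rho / (alpha + rho + 1))).
Proof.
move=> C0 K0 rho0 dpsiP dphi_le.
have [dpsi_in _ _] := dpsiP.
have cpsi := is_derivative_on_continuous uv dpsiP.
have cpsi' := within_continuous_reflect uv cpsi.
pose phi t := psi t + psi (u + v - t).
pose g t := C * t + K / (rho + 1) * (t - u) `^ (rho + 1).
have rho1 : 0 < rho + 1 by rewrite ltr_wpDl.
have cphi : {within `[u, v], continuous phi}.
  by move=> x; exact: (continuousD (cpsi x) (cpsi' x)).
have cpow := within_continuous_powR_shift uv rho1.
have ccst (c : R) : {within `[u, v], continuous (fun _ : R => c)}.
  by apply: continuous_subspaceT => x; exact: cst_continuous.
have cid : {within `[u, v], continuous (fun x : R => x)}.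
  by apply: continuous_subspaceT => x; exact: cvg_id.
have cg : {within `[u, v], continuous g}.
  move=> x; exact: (continuousD (continuousM (ccst C x) (cid x))
    (continuousM (ccst (K / (rho + 1)) x) (cpow x))).
pose m := (u + v) / 2.
have [um mv] : u < m /\ m < v by rewrite /m !midf_lt.
have phi_le t : t \in `[m, v] -> `|phi v - phi t| <= g v - g t.
  apply: (@mean_value_bound R m v phi g (fun x => dpsi x - dpsi (u + v - x))
    (fun x => C + K * (x - u) `^ rho)).
  - apply: continuous_subspaceW cphi.
    by apply: subset_itvr; rewrite bnd_simp ltW.
  - apply: continuous_subspaceW cg.
    by apply: subset_itvr; rewrite bnd_simp ltW.
  - move=> x; rewrite in_itv/= => /andP[mx xv]; split.
    + have -> : dpsi x - dpsi (u + v - x)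
          = dpsi x + dpsi (u + v - x) * (- 1) by ring.
      apply: is_deriveD; first by apply: dpsi_in; rewrite (lt_trans um mx).
      apply: (@is_derive1_comp R psi (fun y => u + v - y)).
        by apply: dpsi_in; have := lt_trans um mx; lra.
      apply: is_derive_eq (is_deriveB (is_derive_cst (u + v) x (1 : R))
        (is_derive_id x (1 : R))) _.
      by rewrite sub0r.
    + apply: is_derive_eq (is_deriveD
        (is_deriveM (is_derive_cst C x (1 : R)) (is_derive_id x (1 : R)))
        (is_deriveM (is_derive_cst (K / (rho + 1)) x (1 : R))
           (is_derive_powR_shift (rho + 1) (lt_trans um mx)))) _.
      rewrite /GRing.scale/= !mulr0 !addr0 mulr1 addrK; field.
      by rewrite gt_eqF.
    + by apply: dphi_le; rewrite mx xv.
pose B t := C * Num.min (t - u) (v - t)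
  + K / (rho + 1) * ((v - u) `^ (rho + 1) - (t - u) `^ (rho + 1)).
have phi_leB t : t \in `[u, v] -> `|phi v - phi t| <= B t.
  rewrite in_itv/= => /andP[ut tv]; have [tm|mt] := ltP t m.
    have tE : u + v - t \in `[m, v].
      by rewrite in_itv/=; move: tm; rewrite /m => tm; apply/andP; split; lra.
    have -> : phi t = phi (u + v - t).
      by rewrite /phi addrC; congr (_ + psi _); ring.
    apply: le_trans (phi_le _ tE) _; rewrite /g /B min_l; last first.
      by move: tm; rewrite /m; lra.
    have powle : (t - u) `^ (rho + 1) <= (u + v - t - u) `^ (rho + 1).
      apply: ge0_ler_powR; rewrite ?nnegrE; [exact: ltW|lra|lra|].
      by move: tm; rewrite /m; lra.
    have : K / (rho + 1) * (t - u) `^ (rho + 1)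
        <= K / (rho + 1) * (u + v - t - u) `^ (rho + 1).
      by rewrite ler_wpM2l// divr_ge0// ltW.
    by lra.
  apply: le_trans (phi_le _ _) _; first by rewrite in_itv/= mt tv.
  by rewrite /g /B min_r; [lra|move: mt; rewrite /m; lra].
have cB : {within `[u, v], continuous B}.
  move=> x; exact: (continuousD (continuousM (ccst C x) (@cmin x))
    (continuousM (ccst (K / (rho + 1)) x)
       (continuousB (ccst ((v - u) `^ (rho + 1)) x) (cpow x)))).
have iB : mu.-integrable `[u, v] (EFin \o (fun t => w t * B t)).
  exact: integrable_powR_mul.
have intB : \int[mu]_(t in `[u, v]) (w t * B t) = (v - u) `^ alpha / alpha * ((v - u) *
    (C * ((1 - 2 `^ (- alpha)) / (alpha + 1))
     + K * ((v - u) `^ rho / (alpha + rho + 1)))).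
  have ar0 : 0 < alpha + rho by rewrite ltr_wpDr.
  have ar1 : -1 < alpha + rho by rewrite (lt_trans _ ar0)// ltrN10.
  have imin := integrable_powR_mul uv p1 cmin.
  have iw := integrable_powR_shift uv p1.
  have ia := integrable_powR_shift uv ar1.
  have -> : \int[mu]_(t in `[u, v]) (w t * B t) =
      \int[mu]_(t in `[u, v]) (C * (w t * Num.min (t - u) (v - t))
      + (K / (rho + 1) * ((v - u) `^ (rho + 1) * w t)
         - K / (rho + 1) * (t - u) `^ (alpha + rho))).
    apply: eq_Rintegral => t _.
    have -> : (t - u) `^ (alpha + rho) = w t * (t - u) `^ (rho + 1).
      have E : alpha + rho = (alpha - 1) + (rho + 1) by ring.
      by rewrite E powRD// -E gt_eqF.
    by rewrite /B; ring.
  have intZ (k : R) (f : R -> R) : mu.-integrable `[u, v] (EFin \o f) ->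
      mu.-integrable `[u, v] (EFin \o (fun t => k * f t)).
    by move=> fi; exact: (integrableZl _ k fi).
  have j2 : mu.-integrable `[u, v]
      (EFin \o (fun t => K / (rho + 1) * ((v - u) `^ (rho + 1) * w t))).
    exact: (intZ _ _ (intZ _ _ iw)).
  have j3 : mu.-integrable `[u, v]
      (EFin \o (fun t => K / (rho + 1) * (t - u) `^ (alpha + rho))).
    exact: intZ.
  rewrite RintegralD//; [|exact: intZ|exact: (integrableB _ j2 j3)].
  rewrite RintegralB// !RintegralZl//; last exact: intZ.
  rewrite Rintegral_powR_min integral_w// Rintegral_powR_shift//.
  have Lp (b : R) : 0 <= b -> (v - u) `^ (b + 1) = (v - u) `^ b * (v - u).
    move=> b0; rewrite powRD; last by rewrite (gt_eqF L0) implybT.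
    by rewrite powRr1// ltW.
  rewrite !Lp// ?ltW// powRD; last by rewrite (gt_eqF L0) implybT.
  by field; rewrite !gt_eqF// addr_gt0.
rewrite trapezoid_defectE// -/phi normrM ger0_norm; last first.
  by rewrite divr_ge0 ?(ltW alpha0)// mulr_ge0 ?powR_ge0.
have La : (v - u) `^ alpha != 0 by rewrite gt_eqF ?powR_gt0.
apply: (@le_trans _ _ (alpha / (2 * (v - u) `^ alpha) *
    \int[mu]_(t in `[u, v]) (w t * B t))); last first.
  rewrite intB le_eqVlt; apply/orP; left; apply/eqP; field.
  by rewrite La !gt_eqF// addr_gt0// ltr_wpDr.
apply: ler_wpM2l.
  by rewrite divr_ge0 ?(ltW alpha0)// mulr_ge0 ?powR_ge0.
have iphi : mu.-integrable `[u, v] (EFin \o (fun t => w t * (phi v - phi t))).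
  apply: integrable_powR_mul => // x.
  exact: (continuousB (@cst_continuous _ _ (phi v) x) (cphi x)).
apply: le_trans (le_normr_Rintegral _ iphi) _ => //.
apply: le_Rintegral => //.
  exact: integrable_norm.
move=> t tuv; rewrite normrM ger0_norm ?powR_ge0// ler_wpM2l ?powR_ge0//.
exact: phi_leB.
Qed.
End trapezoid.

(** * Darboux's theorem and power means *)

(** Darboux's theorem: a minimum of [f] over the segment is interior, because at
    [x] the one-sided difference quotients would be nonnegative, and at [y]
    nonpositive. *)
Lemma derive_sign_change (R : realType) (f df : R -> R) (x y : R) : x < y ->
  (forall z, x <= z <= y -> is_derive z (1 : R) f (df z)) ->
  df x < 0 < df y -> exists2 z, x < z < y & df z = 0.
Proof.
move=> xy dfP /andP[dx0 dy0].
have quot z : x <= z <= y -> (fun h => h^-1 * (f (h + z) - f z)) @ (0 : R)^' --> df z.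
  move=> /dfP dz; have /= := @ex_derive _ _ _ _ _ _ _ dz.
  rewrite -[X in _ --> X](@derive_val _ _ _ _ _ _ _ dz) /derivable /derive.
  have -> : (fun h => h^-1 * (f (h + z) - f z))
      = (fun h => h^-1 *: ((f \o shift z) (h *: (1 : R)) - f z)).
    by apply/funext => h /=; rewrite [h *: 1]mulr1.
  exact.
have cf : {within `[x, y], continuous f}.
  apply: continuous_in_subspaceT => z /set_mem/=; rewrite in_itv/= => /dfP.
  exact: is_derive_continuous.
have [z zxy fz] := EVT_min (ltW xy) cf.
have zxy' : x <= z <= y by move: zxy; rewrite in_itv.
have [zx|zx] := eqVneq z x.
  have : 0 <= df x; last by rewrite leNgt dx0.
  have xx : x <= x <= y by rewrite lexx ltW.
  apply: (cvgr_to_ge (cvg_dnbhs_at_right (quot x xx))).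
  near=> h; apply: mulr_ge0; first by rewrite invr_ge0.
  rewrite subr_ge0 -{1}zx; apply: fz; rewrite in_itv/= lerDr.
  apply/andP; split => //; rewrite -lerBrDr.
  by near: h; apply: nbhs_right_le; rewrite subr_gt0.
have [zy|zy] := eqVneq z y.
  have : df y <= 0; last by rewrite leNgt dy0.
  have yy : x <= y <= y by rewrite lexx ltW.
  apply: (cvgr_to_le (cvg_dnbhs_at_left (quot y yy))).
  near=> h; apply: mulr_le0_ge0; first by rewrite invr_le0.
  rewrite subr_ge0 -{1}zy; apply: fz; rewrite in_itv/= gerDr.
  apply/andP; split => //; rewrite -lerBlDr.
  by near: h; apply: nbhs_left_ge; rewrite subr_lt0.
have zoo : x < z < y.
  by move: zxy'; rewrite !le_eqVlt (negbTE zy) eq_sym (negbTE zx).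
exists z => //.
have dz0 : is_derive z (1 : R) f 0.
  apply: (derive1_at_min (ltW xy)).
  - by move=> t /subset_itv_oo_cc; rewrite /= in_itv/= => /dfP ?; exact: ex_derive.
  - by rewrite in_itv.
  - by move=> t /subset_itv_oo_cc/fz.
by rewrite -(@derive_val _ _ _ _ _ _ _ (dfP _ zxy')) derive_val.
Unshelve. all: by end_near. Qed.

(** Concavity of the logarithm. *)
Lemma weighted_AGM (R : realType) (x y th : R) : 0 < x -> 0 < y ->
  0 <= th <= 1 -> x `^ (1 - th) * y `^ th <= (1 - th) * x + th * y.
Proof.
move=> x0 y0 /andP[th0 th1].
have := concave_ln (Itv01 th0 th1) y0 x0; rewrite !convRE/= /unstable.onem.
have xy0 : 0 < th * y + (1 - th) * x.
  have [->|th1'] := eqVneq th 1; first by rewrite mul1r subrr mul0r addr0.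
  apply: ltr_wpDl; first by rewrite mulr_ge0// ltW.
  by rewrite mulr_gt0// subr_gt0 lt_neqAle th1'.
rewrite -[_ <= ln _]ler_expR lnK ?posrE// expRD => h.
rewrite [leRHS]addrC; apply: le_trans h.
by rewrite mulrC /powR (gt_eqF x0) (gt_eqF y0).
Qed.

(** [a^q = a a^(q - 1) <= a (a + b)^(q - 1)], and likewise for [b]. *)
Lemma powR_add_le (R : realType) (a b q : R) : 0 <= a -> 0 <= b -> 1 <= q ->
  a `^ q + b `^ q <= (a + b) `^ q.
Proof.
move=> a0 b0 q1; have q0 : 0 < q by rewrite (lt_le_trans ltr01).
rewrite -(mulr_powRB1 a0 q0) -(mulr_powRB1 b0 q0).
rewrite -(mulr_powRB1 (addr_ge0 a0 b0) q0) mulrDl.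
by apply: lerD; apply: ler_wpM2l => //;
  apply: ge0_ler_powR; rewrite ?subr_ge0 ?nnegrE ?addr_ge0// (lerDl, lerDr).
Qed.

(** Convexity of [y -> y^q] at the midpoint of [a] and [b]. *)
Lemma add_le_powR_mean (R : realType) (a b q : R) : 0 <= a -> 0 <= b -> 1 <= q ->
  a + b <= 2 `^ (1 - 1 / q) * (a `^ q + b `^ q) `^ (1 / q).
Proof.
move=> a0 b0 q1; have q0 : 0 < q by rewrite (lt_le_trans ltr01).
have h0 : (0 : R) <= 2^-1 by [].
have h1 : (2^-1 : R) <= 1 by rewrite invf_le1// ler1n.
have := @convex_powR R q q1 (Itv01 h0 h1) a b.
rewrite !convRE/= !inE/= !in_itv/= !andbT => /(_ a0 b0).
rewrite /unstable.onem (_ : 1 - 2^-1 = 2^-1 :> R); last by lra.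
rewrite -!mulrDr => conv.
have : ((2^-1 * (a + b)) `^ q) `^ (1 / q)
    <= (2^-1 * (a `^ q + b `^ q)) `^ (1 / q).
  apply: ge0_ler_powR => //; rewrite ?nnegrE ?powR_ge0//.
    by rewrite divr_ge0// ltW.
    by rewrite mulr_ge0// addr_ge0// powR_ge0.
  rewrite (_ : 2^-1 * (a + b) = convex.conv (Itv01 h0 h1) (a : R^o) b)//.
  by rewrite convRE/= /unstable.onem; lra.
rewrite -powRrM div1r mulfV ?gt_eqF// powRr1 ?mulr_ge0 ?addr_ge0//.
rewrite powRM ?addr_ge0 ?powR_ge0// => h.
rewrite powRB ?pnatr_eq0 ?implybT// powRr1//.
have -> : (2 : R) / 2 `^ q^-1 = 2 * 2^-1 `^ q^-1.
  by rewrite -(@powR_inv1 R 2)// -powRrM mulN1r powRN.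
lra.
Qed.

(** * The reflected difference of a derivative with convex power *)

Lemma norm_le_of_powR (R : realType) (q p tau c d : R) : 1 <= q -> 0 <= c ->
  `|d| `^ q <= tau `^ p * c `^ q -> `|d| <= c * tau `^ (p / q).
Proof.
move=> q1 c0 dle; have q0 : 0 < q by rewrite (lt_le_trans ltr01).
have : (`|d| `^ q) `^ q^-1 <= (tau `^ p * c `^ q) `^ q^-1.
  by apply: ge0_ler_powR => //; rewrite ?nnegrE ?mulr_ge0 ?powR_ge0 ?invr_ge0 ?ltW.
rewrite powRM ?powR_ge0// -!powRrM mulfV ?gt_eqF// !powRr1//.
by rewrite mulrC.
Qed.

Lemma norm_sub_le (R : realFieldType) (a b M : R) :
  `|a| <= M -> `|b| <= M -> 0 <= a * b -> `|a - b| <= M.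
Proof.
rewrite !ler_norml => /andP[a1 a2] /andP[b1 b2].
have [a0|a0|a0] := ltgtP 0 a.
- by rewrite pmulr_rge0// => b0; apply/andP; split; lra.
- by rewrite nmulr_rge0// => b0; apply/andP; split; lra.
- by move=> _; apply/andP; split; lra.
Qed.

Section convex_derivative.
Variables (R : realType) (alpha s q u v : R) (psi dpsi : R -> R).
Hypotheses (alpha0 : 0 < alpha) (s0 : 0 < s) (q1 : 1 <= q) (uv : u < v).
Hypothesis (dpsiP : is_derivative_on u v psi dpsi).
Hypothesis (dpsi_convex :
  generalized_s_convex alpha s `[u, v] (fun x => `|dpsi x| `^ q)).
Let p := alpha * s.
Let p0 : 0 < p. Proof. exact: mulr_gt0. Qed.
Let q0 : 0 < q. Proof. exact: lt_le_trans q1. Qed.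
Let L0 : 0 < v - u. Proof. by rewrite subr_gt0. Qed.

Let pow_le (x y r : R) : 0 <= r -> 0 <= x -> x <= y -> x `^ r <= y `^ r.
Proof.
by move=> r0 x0 xy; apply: ge0_ler_powR; rewrite ?nnegrE// (le_trans x0).
Qed.

(** Convexity between the two endpoints, where [tau] is the larger of the two
    weights. *)
Let dpsi_le_sum (tau x : R) : 1 / 2 <= tau <= 1 ->
  x = tau * v + (1 - tau) * u \/ x = tau * u + (1 - tau) * v ->
  `|dpsi x| <= (`|dpsi u| + `|dpsi v|) * tau `^ (p / q).
Proof.
move=> /andP[tau2 tau1] xE; apply: norm_le_of_powR => //.
have le_sum (a b : R) : `[u, v]%classic a -> `[u, v]%classic b ->
    `|dpsi (tau * a + (1 - tau) * b)| `^ q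
    <= tau `^ p * (`|dpsi a| + `|dpsi b|) `^ q.
  move=> auv buv.
  apply: le_trans (dpsi_convex auv buv _) _; first by apply/andP; split; lra.
  apply: (@le_trans _ _ (tau `^ p * (`|dpsi a| `^ q + `|dpsi b| `^ q))).
    rewrite mulrDr lerD2l ler_wpM2r ?powR_ge0//.
    by apply: pow_le; [exact: ltW|lra|lra].
  by rewrite ler_wpM2l ?powR_ge0// powR_add_le.
have uP : `[u, v]%classic u by rewrite /= in_itv/= lexx ltW.
have vP : `[u, v]%classic v by rewrite /= in_itv/= lexx ltW.
by case: xE => ->; [rewrite [`|dpsi u| + _]addrC|]; exact: le_sum.
Qed.

(** At a zero [z] of the derivative its term in the convexity inequality
    disappears, so that only the endpoint [e] contributes. *)
Let dpsi_le_zero (x e z sigma tau : R) : u <= z <= v -> u <= e <= v ->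
  dpsi z = 0 -> x = sigma * e + (1 - sigma) * z -> 0 <= sigma <= 1 ->
  sigma <= tau -> `|dpsi x| <= `|dpsi e| * tau `^ (p / q).
Proof.
move=> zuv euv dz xE /andP[sigma0 sigma1] st.
apply: norm_le_of_powR => //.
have eP : `[u, v]%classic e by rewrite /= in_itv.
have zP : `[u, v]%classic z by rewrite /= in_itv.
rewrite xE; apply: le_trans (dpsi_convex eP zP _) _; first by rewrite sigma0.
rewrite /= dz normr0 (powR0 (lt0r_neq0 q0)) mulr0 addr0.
by rewrite ler_wpM2r ?powR_ge0//; apply: pow_le => //; exact: ltW.
Qed.

(** With the same sign the difference is bounded by the larger value; otherwise
    there is a zero [z] between [y] and [x], and the weights of the endpoints in the
    representations of [x] and [y] over [z, v] and [u, z] are at most [tau]. *)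
Lemma reflected_derivative_le (x : R) : (u + v) / 2 < x < v ->
  `|dpsi x - dpsi (u + v - x)|
  <= (`|dpsi u| + `|dpsi v|) * ((x - u) / (v - u)) `^ (p / q).
Proof.
move=> /andP[mx xv]; set y := u + v - x; set tau := (x - u) / (v - u).
have y_refl : y = u + v - x by [].
have tauL : tau * (v - u) = x - u by rewrite divfK// gt_eqF.
have tau2 : 1 / 2 <= tau by rewrite ler_pdivlMr//; lra.
have tau1 : tau <= 1 by rewrite ler_pdivrMr//; lra.
clearbody y tau.
have xE : x = tau * v + (1 - tau) * u by lra.
have yE : y = tau * u + (1 - tau) * v by lra.
have [ux uy yv yx] : [/\ u < x, u < y, y < v & y < x] by split; lra.
have xle : `|dpsi x| <= (`|dpsi u| + `|dpsi v|) * tau `^ (p / q).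
  by apply: dpsi_le_sum; [rewrite tau2|left].
have yle : `|dpsi y| <= (`|dpsi u| + `|dpsi v|) * tau `^ (p / q).
  by apply: dpsi_le_sum; [rewrite tau2|right].
have [same|opp] := leP 0 (dpsi x * dpsi y).
  exact: norm_sub_le.
have [z zyx dz] : exists2 z, y < z < x & dpsi z = 0.
  have [dpsi_in _ _] := dpsiP.
  have dzP t : y <= t <= x -> is_derive t (1 : R) psi (dpsi t).
    move=> /andP[yt tx]; apply: dpsi_in.
    by rewrite (lt_le_trans uy yt) (le_lt_trans tx xv).
  (* The second sign pattern is the first one for [- psi]. *)
  have [dx|dx|dx] := ltgtP 0 (dpsi x).
  - move: opp; rewrite pmulr_rlt0// => dy.
    by apply: derive_sign_change dzP _ => //; rewrite dx dy.
  - move: opp; rewrite nmulr_rlt0// => dy.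
    have dzN t : y <= t <= x -> is_derive t (1 : R) (- psi) (- dpsi t).
      by move=> /dzP ?; exact: is_deriveN.
    have [|z zyx dz] := derive_sign_change yx dzN.
      by rewrite oppr_lt0 oppr_gt0 dx dy.
    by exists z => //; apply/eqP; rewrite -oppr_eq0 dz.
  - by move: opp; rewrite -dx mul0r ltxx.
have /andP[yz zx] := zyx.
have zuv : u <= z <= v by apply/andP; split; lra.
have xle' : `|dpsi x| <= `|dpsi v| * tau `^ (p / q).
  have vz : 0 < v - z by lra.
  apply: (@dpsi_le_zero x v z ((x - z) / (v - z)) tau) => //.
  - by rewrite lexx ltW.
  - by field; rewrite gt_eqF.
  - by rewrite divr_ge0 ?ler_pdivrMr//; lra.
  - rewrite ler_pdivrMr// -subr_ge0.
    rewrite (_ : _ - _ = (1 - tau) * (z - u)); last by rewrite xE; ring.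
    by rewrite mulr_ge0; lra.
have yle' : `|dpsi y| <= `|dpsi u| * tau `^ (p / q).
  have zu : 0 < z - u by lra.
  apply: (@dpsi_le_zero y u z ((z - y) / (z - u)) tau) => //.
  - by rewrite lexx ltW.
  - by field; rewrite gt_eqF.
  - by rewrite divr_ge0 ?ler_pdivrMr//; lra.
  - rewrite ler_pdivrMr// -subr_ge0.
    rewrite (_ : _ - _ = (1 - tau) * (v - z)); last by rewrite yE; ring.
    by rewrite mulr_ge0; lra.
apply: le_trans (ler_normB _ _) _.
by rewrite mulrDl addrC lerD.
Qed.
End convex_derivative.

(** * The bounds *)

Lemma Euler_Beta_ge0 (R : realType) (x y : R) : 0 <= Euler_Beta x y.
Proof. by apply: Rintegral_ge0 => t _; rewrite mulr_ge0 ?powR_ge0. Qed.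

Lemma Euler_Beta22 (R : realType) : Euler_Beta (1 + 1) (1 + 1) = 1 / 6 :> R.
Proof.
have p1 : -1 < 1 :> R by lra.
have p2 : -1 < 2 :> R by lra.
transitivity (\int[lebesgue_measure]_(t in `[0 : R, 1])
    ((t - 0) `^ 1 - (t - 0) `^ 2)).
  apply: eq_Rintegral => t /set_mem/=; rewrite in_itv/= => /andP[t0 t1].
  rewrite addrK subr0 !powRr1 ?subr_ge0// powR_mulrn//; ring.
rewrite RintegralB//; [|exact: integrable_powR_shift|exact: integrable_powR_shift].
by rewrite !Rintegral_powR_shift// subr0 !powR1; field.
Qed.

Lemma powR_invl (R : realType) (x r : R) : 0 <= x ->
  x^-1 `^ r = (x `^ r)^-1.
Proof. by move=> x0; rewrite -(powR_inv1 x0) -powRrM mulN1r powRN. Qed.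

(** The value of the tangent bound at the optimal point of tangency. *)
Lemma div_powR_div (R : realType) (x y th : R) : 0 < x -> 0 < y ->
  y / (y / x) `^ (1 - th) = x `^ (1 - th) * y `^ th.
Proof.
move=> x0 y0; have xp := powR_gt0 (1 - th) x0; have yp := powR_gt0 th y0.
rewrite powRM ?invr_ge0 ?(ltW x0) ?(ltW y0)// (powR_invl _ (ltW x0)).
rewrite [y `^ (1 - th)]powRB ?(gt_eqF y0) ?implybT// (powRr1 (ltW y0)).
by field; rewrite !gt_eqF.
Qed.

Section bounds.
Variables (R : realType) (alpha s q u v : R) (psi dpsi : R -> R).
Hypotheses (alpha0 : 0 < alpha) (s0 : 0 < s) (q1 : 1 <= q) (uv : u < v).
Hypothesis (dpsiP : is_derivative_on u v psi dpsi).
Hypothesis (dpsi_convex :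
  generalized_s_convex alpha s `[u, v] (fun x => `|dpsi x| `^ q)).
Let a := `|dpsi u|.
Let b := `|dpsi v|.
Let p := alpha * s.
Let th := 1 / q.
Let p0 : 0 < p. Proof. exact: mulr_gt0. Qed.
Let q0 : 0 < q. Proof. exact: lt_le_trans q1. Qed.
Let th0 : 0 <= th. Proof. by rewrite /th divr_ge0// ltW. Qed.
Let th1 : th <= 1. Proof. by rewrite /th div1r invf_le1. Qed.
Let th01 : 0 <= th <= 1. Proof. by rewrite th0. Qed.
Let ab0 : 0 <= a + b. Proof. by rewrite addr_ge0 ?normr_ge0. Qed.
Let L0 : 0 < v - u. Proof. by rewrite subr_gt0. Qed.
Let Lp (r : R) : 0 < (v - u) `^ r. Proof. by rewrite powR_gt0. Qed.

Let expE : (q - 1) / q = 1 - th.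
Proof. by rewrite /th mulrBl mulfV ?gt_eqF// mul1r div1r. Qed.

Let ratio_powR (x r : R) : u < x ->
  ((x - u) / (v - u)) `^ r = (x - u) `^ r / (v - u) `^ r.
Proof.
by move=> ux; rewrite powRM ?invr_ge0 ?subr_ge0 ?ltW// powR_invl// ltW.
Qed.

(** The pure power bound [(a + b) tau^(p/q)] contributes
    [(a + b) / (alpha + p/q + 1)], and [alpha + p/q + 1] is the weighted arithmetic
    mean of [alpha + 1] and [alpha + p + 1]. *)
Lemma trapezoid_defect_le_sum :
  `|trapezoid_defect u v alpha psi| <= (v - u) / 2
    * (1 / (alpha + 1)) `^ ((q - 1) / q)
    * (Euler_Beta (p + 1) (alpha + 1) + 1 / (alpha * (s + 1) + 1)) `^ (1 / q)
    * (a + b).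
Proof.
rewrite expE -/th; set r := p / q.
have r0 : 0 <= r by rewrite /r divr_ge0// ltW.
have rE : r = th * p by rewrite /r /th; ring.
apply: le_trans (trapezoid_defect_le uv alpha0 (C := 0) (K := (a + b) / (v - u) `^ r)
  (rho := r) _ _ r0 dpsiP _) _ => //.
- by rewrite divr_ge0// ltW.
- move=> x xuv; have ux : u < x by move: xuv => /andP[]; lra.
  rewrite add0r mulrAC -mulrA -ratio_powR//.
  exact: (reflected_derivative_le alpha0 s0 q1 uv dpsiP dpsi_convex xuv).
rewrite mul0r add0r mulf_div [_ * (v - u) `^ r]mulrC -mulf_div divff ?gt_eqF// mul1r.
rewrite -!mulrA ler_wpM2l ?(ltW L0)// ler_wpM2l//.
rewrite mulrA [leRHS]mulrC ler_wpM2l// !div1r.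
have X0 : 0 < alpha + 1 by rewrite addr_gt0.
have Y0 : 0 < alpha * (s + 1) + 1.
  by rewrite addr_gt0// mulr_gt0// addr_gt0.
have XY0 : 0 < (alpha + 1) `^ (1 - th) * (alpha * (s + 1) + 1) `^ th.
  by rewrite mulr_gt0// powR_gt0.
have ar0 : 0 < alpha + r + 1 by rewrite addr_gt0// ltr_wpDr.
apply: (@le_trans _ _ ((alpha + 1)^-1 `^ (1 - th)
    * (alpha * (s + 1) + 1)^-1 `^ th)).
  rewrite (powR_invl _ (ltW X0)) (powR_invl _ (ltW Y0)) -invfM lef_pV2 ?posrE//.
  apply: le_trans (weighted_AGM X0 Y0 th01) _.
  by rewrite rE /p le_eqVlt; apply/orP; left; apply/eqP; ring.
rewrite ler_wpM2l ?powR_ge0//; apply: ge0_ler_powR => //.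
- by rewrite nnegrE invr_ge0 ltW.
- by rewrite nnegrE addr_ge0 ?Euler_Beta_ge0// invr_ge0 ltW.
- by rewrite lerDr Euler_Beta_ge0.
Qed.

(** The tangent of [y -> y^(1/q)] at [k = Y / X] splits the pointwise bound into a
    constant and a multiple of [tau^p], whose contributions [X] and [Y] recombine to
    [X^(1 - 1/q) Y^(1/q)] for this choice of [k]. The condition on [alpha] makes
    [1 - 2^(- alpha) <= 1/2]. *)
Lemma trapezoid_defect_le_mean : alpha <= 1 ->
  `|trapezoid_defect u v alpha psi| <= (v - u) / 2
    * (1 / (1 + alpha)) `^ ((q - 1) / q)
    * (Euler_Beta (p + 1) (alpha + 1) + 1 / (1 + (alpha + p))) `^ (1 / q)
    * (a `^ q + b `^ q) `^ (1 / q).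
Proof.
move=> alpha1; rewrite expE -/th.
pose X : R := (2 * (1 + alpha))^-1; pose Y : R := (1 + (alpha + p))^-1.
have X0 : 0 < X by rewrite invr_gt0 mulr_gt0// addr_gt0.
have Y0 : 0 < Y by rewrite invr_gt0 !addr_gt0.
(* Up to the factor [(v - u) / 2], [X] bounds the contribution of the constant 1
   in [trapezoid_defect_le], and [Y] is that of [tau^p]. *)
pose k := Y / X; have k0 : 0 < k by rewrite divr_gt0.
pose e := k `^ (1 - th); have e0 : 0 < e by rewrite powR_gt0.
have young (t : R) : 0 < t -> t `^ (p / q) <= ((1 - th) * k + th * t `^ p) / e.
  move=> t0; rewrite ler_pdivlMr// (_ : p / q = p * th); last by rewrite /th; ring.
  by rewrite powRrM mulrC; apply: weighted_AGM => //; rewrite powR_gt0.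
pose C := (a + b) * ((1 - th) * k / e).
pose K := (a + b) * (th / e) / (v - u) `^ p.
have C0 : 0 <= C.
  by rewrite mulr_ge0// divr_ge0 ?(ltW e0)// mulr_ge0 ?subr_ge0 ?(ltW k0).
have K0 : 0 <= K by rewrite divr_ge0 ?(ltW (Lp p))// mulr_ge0// divr_ge0 ?(ltW e0).
apply: le_trans (trapezoid_defect_le uv alpha0 C0 K0 (ltW p0) dpsiP _) _.
  move=> x xuv; have ux : u < x by move: xuv => /andP[]; lra.
  apply: (le_trans (reflected_derivative_le alpha0 s0 q1 uv dpsiP dpsi_convex xuv)).
  rewrite -/a -/b -/p.
  have -> : C + K * (x - u) `^ p
      = (a + b) * (((1 - th) * k + th * ((x - u) / (v - u)) `^ p) / e).
    by rewrite ratio_powR// /C /K; field; rewrite !gt_eqF.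
  by rewrite ler_wpM2l// young// divr_gt0// subr_gt0.
have X_ge : (1 - 2 `^ (- alpha)) / (alpha + 1) <= X.
  have aX : 0 <= (alpha + 1)^-1 by rewrite invr_ge0 addr_ge0 ?(ltW alpha0).
  rewrite /X invfM [1 + alpha]addrC ler_wpM2r//.
  have : (2 : R) `^ (- 1) <= 2 `^ (- alpha) by rewrite ler_powR ?ler1n// lerN2.
  by rewrite powR_inv1//; lra.
have bound : C * ((1 - 2 `^ (- alpha)) / (alpha + 1))
    + K * ((v - u) `^ p / (alpha + p + 1)) <= (a + b) * (X `^ (1 - th) * Y `^ th).
  apply: (@le_trans _ _ (C * X + (a + b) * (th / e) * Y)).
    apply: lerD; first by rewrite ler_wpM2l.
    rewrite /K mulf_div [_ * (v - u) `^ p]mulrC -mulf_div divff ?gt_eqF// mul1r.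
    by rewrite /Y (_ : 1 + (alpha + p) = alpha + p + 1)//; ring.
  have kX : k * X = Y by rewrite /k divfK ?gt_eqF.
  have -> : C * X + (a + b) * (th / e) * Y = (a + b) * (Y / e).
    have -> : C * X = (a + b) * ((1 - th) * (k * X) / e) by rewrite /C; ring.
    by rewrite kX; ring.
  by rewrite /e /k div_powR_div.
apply: (@le_trans _ _ ((v - u) / 2 * ((a + b) * (X `^ (1 - th) * Y `^ th)))).
  apply: ler_wpM2l; last exact: bound.
  by rewrite divr_ge0// ltW.
rewrite -!mulrA ler_wpM2l ?(ltW L0)// ler_wpM2l//.
have XE : 2 `^ (1 - th) * X `^ (1 - th) = (1 / (1 + alpha)) `^ (1 - th).
  rewrite -powRM ?(ltW X0)// /X; congr (_ `^ _); field.
  by rewrite gt_eqF// addr_gt0.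
rewrite -XE.
have := add_le_powR_mean (normr_ge0 (dpsi u)) (normr_ge0 (dpsi v)) q1.
rewrite -/a -/b -/th => ab_le.
apply: (@le_trans _ _ (2 `^ (1 - th) * (a `^ q + b `^ q) `^ th
    * (X `^ (1 - th) * Y `^ th))).
  by rewrite ler_wpM2r// mulr_ge0 ?powR_ge0.
rewrite -!mulrA ler_wpM2l ?powR_ge0// mulrCA ler_wpM2l ?powR_ge0//.
rewrite mulrC ler_wpM2r ?powR_ge0//.
apply: ge0_ler_powR => //; rewrite ?nnegrE ?(ltW Y0)//.
  by rewrite addr_ge0 ?Euler_Beta_ge0// div1r ltW.
by rewrite div1r lerDr Euler_Beta_ge0.
Qed.

(** Taking both points equal and both weights 1/2 in the convexity inequality gives
    [f x <= 2^(1 - p) f x] for [f = |psi'|^q >= 0], where [2^(1 - p) < 1]. *)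
Lemma derivative_eq0 (x : R) : 1 < p -> x \in `[u, v] -> dpsi x = 0.
Proof.
move=> p1 xuv.
have xP : `[u, v]%classic x by [].
have h01 : 0 <= (1 / 2 : R) <= 1 by apply/andP; split; lra.
have := dpsi_convex xP xP h01.
rewrite (_ : 1 / 2 * x + (1 - 1 / 2) * x = x); last by field.
rewrite (_ : 1 - 1 / 2 = 1 / 2 :> R); last by field.
rewrite -mulrDl -/p => fx.
have hp : (1 / 2 : R) `^ p < 1 / 2.
  have h0 : 0 < (1 / 2 : R) by lra.
  rewrite /powR (gt_eqF h0) -[ltRHS](lnK (_ : 1 / 2 \is Num.pos)) ?posrE//.
  rewrite ltr_expR -[ltRHS]mul1r ltr_nM2r// ln_lt0//.
  by apply/andP; split; lra.
have : `|dpsi x| `^ q <= 0.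
  have := powR_ge0 `|dpsi x| q; move: fx.
  move: (_ `^ q) hp => f hp; nra.
rewrite le_eqVlt ltNge powR_ge0 orbF powR_eq0 normr_eq0.
by move=> /andP[/eqP].
Qed.

End bounds.

Theorem corollary1 (R : realType) (alpha s q u v : R) (psi dpsi : R -> R)
    (alpha_gt0 : 0 < alpha) (s_itv : 0 < s <= 1) (q_ge1 : 1 <= q)
    (u_ge0 : 0 <= u) (uv : u < v)
    (psi_derivative : is_derivative_on u v psi dpsi)
    (dpsi_L1 : (@lebesgue_measure R).-integrable `[u, v] (EFin \o dpsi))
    (dpsi_convex :
       generalized_s_convex alpha s `[u, v] (fun x => `|dpsi x| `^ q)) :
  [/\ `| (psi u + psi v) / 2
         - Euler_Gamma (alpha + 1) / (2 * (v - u) `^ alpha)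
           * (RL_left alpha u psi v + RL_right alpha v psi u) |
      <= (v - u) / 2
         * (1 / (alpha + 1)) `^ ((q - 1) / q)
         * (Euler_Beta (alpha * s + 1) (alpha + 1)
            + 1 / (alpha * (s + 1) + 1)) `^ (1 / q)
         * (`|dpsi u| + `|dpsi v|),
      s = 1 ->
      `| (psi u + psi v) / 2
         - Euler_Gamma (alpha + 1) / (2 * (v - u) `^ alpha)
           * (RL_left alpha u psi v + RL_right alpha v psi u) |
      <= (v - u) / 2
         * (1 / (1 + alpha)) `^ ((q - 1) / q)
         * (Euler_Beta (alpha + 1) (alpha + 1)
            + 1 / (1 + 2 * alpha)) `^ (1 / q)
         * (`|dpsi u| `^ q + `|dpsi v| `^ q) `^ (1 / q) &
      s = 1 -> alpha = 1 ->
      `| (psi u + psi v) / 2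
         - 1 / (v - u) * \int[lebesgue_measure]_(x in `[u, v]) psi x |
      <= (v - u) / 2
         * (1 / 2) `^ ((q - 1) / q)
         * ((`|dpsi u| `^ q + `|dpsi v| `^ q) / 2) `^ (1 / q)].
Proof.
have /andP[s0 s1] := s_itv.
have part1 := trapezoid_defect_le_sum alpha_gt0 s0 q_ge1 uv psi_derivative
  dpsi_convex.
have part2 : s = 1 -> `|trapezoid_defect u v alpha psi| <= (v - u) / 2
    * (1 / (1 + alpha)) `^ ((q - 1) / q)
    * (Euler_Beta (alpha + 1) (alpha + 1) + 1 / (1 + 2 * alpha)) `^ (1 / q)
    * (`|dpsi u| `^ q + `|dpsi v| `^ q) `^ (1 / q).
  move=> sE; rewrite sE in dpsi_convex.
  have [alpha1|alpha1] := leP alpha 1.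
    have := trapezoid_defect_le_mean alpha_gt0 ltr01 q_ge1 uv psi_derivative
      dpsi_convex alpha1.
    by rewrite mulr1 (_ : alpha + alpha = 2 * alpha)//; ring.
  have dpsi0 x : x \in `[u, v] -> dpsi x = 0.
    by apply: (derivative_eq0 dpsi_convex); rewrite mulr1.
  apply: (@le_trans _ _ 0); last first.
    by rewrite !mulr_ge0 ?powR_ge0// ?subr_ge0 ?invr_ge0 ?ltW.
  apply: le_trans (trapezoid_defect_le uv alpha_gt0 (lexx 0) (lexx 0) (lexx 0)
    psi_derivative _) _; last by rewrite !mul0r addr0 mulr0.
  move=> x /andP[mx xv]; rewrite !dpsi0 ?subrr ?normr0 ?mul0r ?addr0//;
    rewrite in_itv/=; apply/andP; split; lra.
split=> // sE alphaE.
move: part2 => /(_ sE); rewrite /trapezoid_defect /RL_left /RL_right alphaE.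
have weightE (w : R -> R) :
    \int[lebesgue_measure]_(t in `[u, v]) (w t `^ (1 - 1) * psi t)
    = \int[lebesgue_measure]_(t in `[u, v]) psi t.
  by apply: eq_Rintegral => t _; rewrite subrr powRr0 mul1r.
rewrite (weightE (fun t => v - t)) (weightE (fun t => t - u)).
have vu0 : 0 < v - u by rewrite subr_gt0.
have G0 := Euler_Gamma_gt0 (@ltr01 R).
rewrite Euler_GammaD1// Euler_Beta22 (powRr1 (ltW vu0)).
rewrite (_ : 1 * Euler_Gamma 1 / (2 * (v - u)) * _ =
  1 / (v - u) * \int[lebesgue_measure]_(t in `[u, v]) psi t); last first.
  by field; rewrite !gt_eqF.
have S0 : 0 <= `|dpsi u| `^ q + `|dpsi v| `^ q by rewrite addr_ge0 ?powR_ge0.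
rewrite (_ : 1 / 6 + 1 / (1 + 2 * 1) = 2^-1 :> R); last by field.
rewrite (_ : 1 + 1 = 2 :> R)// -[_ * 2^-1 `^ _ * _]mulrA -powRM//.
by rewrite [2^-1 * _]mulrC.
Qed.
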